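(* Let $t\ge 2$, let $(V,\mathcal{B})$ be a $t$-packing $P(t,t+1,v)$, and let $M_{t-1}$ be the binary matrix whose columns correspond to an arbitrary set of $n$ (distinct) blocks of $\mathcal{B}$, whose rows correspond to all $\binom{v}{t-1}$ $(t-1)$-subsets of $V$, and whose $(i,j)$ entry is $1$ if and only if the $(t-1)$-subset of row $i$ is contained in the block of column $j$ (and is $0$ otherwise). Then the Tanner graph corresponding to $M_{t-1}$ is free of $4$-cycles, and so has girth at least $6$.
   Context: A $t$-packing $P(t,k,v)$ is an ordered pair $(V,\mathcal{B})$ where $|V|=v$ and $\mathcal{B}$ is a collection of $k$-subsets (blocks) of $V$ such that every $t$-subset of $V$ occurs in at most one block of $\mathcal{B}$. The Tanner graph of a binary matrix $H$ is the bipartite graph with one vertex for each column and one vertex for each row, where a column vertex and a row vertex are adjacent if and only if the corresponding entry of $H$ is nonzero. The girth of a graph is the length of a shortest cycle ($\infty$ if there is none). *)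

(* Defs.v *)
From HB Require Import structures.
From mathcomp Require Import all_boot all_order all_algebra.

Set Implicit Arguments.
Unset Strict Implicit.
Unset Printing Implicit Defensive.

Import GRing.Theory.

(* The blocks form a set: a repeated block of size k >= t would put its
   t-subsets in two blocks. *)
Definition packing (t k v : nat) (V : finType) (B : {set {set V}}) : Prop :=
  [/\ #|V| = v,
      forall b : {set V}, b \in B -> #|b| = k
    & forall S : {set V}, #|S| = t -> #|[set b in B | S \subset b]| <= 1].

Section Girth.

Variables (T : finType) (e : rel T).

(* For n <= 2, [ucycleb] would accept the empty sequence, loops, and an edge
   traversed back and forth. *)
Definition has_cycle (n : nat) : bool :=
  (2 < n) && [exists c : n.-tuple T, ucycleb e c].

(* [None] is infinity. *)
Definition girth : option nat :=
  ohead [seq n <- iota 0 #|T|.+1 | has_cycle n].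

Lemma has_cycle_leq_card n : has_cycle n -> n <= #|T|.
Proof.
case/andP=> _ /existsP[c /andP[_ Uc]].
by rewrite -[X in X <= _](size_tuple c) -(card_uniqP Uc) max_card.
Qed.

Variant girth_spec : option nat -> Prop :=
  | GirthFinite g of has_cycle g & (forall n, has_cycle n -> g <= n) :
      girth_spec (Some g)
  | GirthInfinite of (forall n, ~~ has_cycle n) : girth_spec None.

Lemma girthP : girth_spec girth.
Proof.
rewrite /girth.
have memE n : (n \in [seq n <- iota 0 #|T|.+1 | has_cycle n]) = has_cycle n.
  rewrite mem_filter mem_iota /= add0n ltnS.
  by case: (boolP (has_cycle n)) => //= /has_cycle_leq_card.
have: sorted ltn [seq n <- iota 0 #|T|.+1 | has_cycle n].
  by apply: sorted_filter; [exact: ltn_trans | exact: iota_ltn_sorted].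
case: (filter _ _) memE => [|g s] memE /= Ps; constructor.
- by move=> n; rewrite -memE.
- by rewrite -memE mem_head.
- move=> n; rewrite -memE inE => /predU1P[-> // | sn].
  by rewrite ltnW // (allP (order_path_min ltn_trans Ps)).
Qed.

End Girth.

Definition leq_ext (n : nat) (g : option nat) : bool :=
  if g is Some m then n <= m else true.

(* [inl j] is the vertex of column [j], [inr i] the vertex of row [i]. *)
Definition tanner (m n : nat) (H : 'M['F_2]_(m, n)) : rel ('I_n + 'I_m) :=
  fun x y => match x, y with
  | inl j, inr i | inr i, inl j => H i j != 0%R
  | _, _ => false
  end.

Definition containment_mx (V : finType) (m n : nat)
    (row_set : 'I_m -> {set V}) (col_block : 'I_n -> {set V}) :
    'M['F_2]_(m, n) :=
  \matrix_(i < m, j < n) (row_set i \subset col_block j)%:R%R.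

(* Main.v *)
(* A 4-cycle gives two distinct (t-1)-sets in two distinct blocks; their union
   has at least t points, so the two blocks share a t-subset, against the
   packing property. Odd cycles are excluded because the Tanner graph is
   bipartite, so no cycle has length less than 6. *)
Require Import Defs.
From mathcomp Require Import all_boot all_order all_algebra.

Lemma exists_subset_card (T : finType) (A : {set T}) (k : nat) :
  k <= #|A| -> exists2 S : {set T}, S \subset A & #|S| = k.
Proof.
move=> kA; have: 0 < #|[set S : {set T} | S \subset A & #|S| == k]|.
  by rewrite cards_draws bin_gt0.
by case/card_gt0P=> S; rewrite inE => /andP[SA /eqP]; exists S.
Qed.

(** Any [t]-subset of [A] lies in both blocks, and the packing allows it only one. *)
Lemma packing_block_inj (t k v : nat) (V : finType) (B : {set {set V}})
    (b1 b2 A : {set V}) :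
  packing t k v B -> b1 \in B -> b2 \in B -> t <= #|A| ->
  A \subset b1 -> A \subset b2 -> b1 = b2.
Proof.
case=> _ _ hB B1 B2 /exists_subset_card[S SA cS] A1 A2.
by apply: (card_le1_eqP (hB S cS)); rewrite inE ?B1 ?B2 (subset_trans SA).
Qed.

(** If the union were no larger than [A], it would equal [A]; then [B] lies in [A], and equal sizes
    force [A = B]. *)
Lemma card_setU_gt (T : finType) (A B : {set T}) :
  #|A| = #|B| -> A != B -> #|A| < #|A :|: B|.
Proof.
move=> cAB; apply: contraNltn => cU.
have /eqP AU : A == A :|: B by rewrite eqEcard subsetUl.
by rewrite eq_sym eqEcard cAB leqnn andbT AU subsetUr.
Qed.

Definition is_column (m n : nat) (x : 'I_n + 'I_m) : bool :=
  if x is inl _ then true else false.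

(** Every edge switches between columns and rows. *)
Lemma is_column_last (m n : nat) (H : 'M['F_2]_(m, n)) x p :
  path (tanner H) x p -> is_column _ _ (last x p) = is_column _ _ x (+) odd (size p).
Proof.
elim: p x => [|y p IHp] x /=; first by rewrite addbF.
by case/andP=> xy /IHp->; case: x y xy => [?|?] [?|?] //= _; case: odd.
Qed.

Lemma tanner_cycle_even (m n : nat) (H : 'M['F_2]_(m, n)) k :
  has_cycle (tanner H) k -> ~~ odd k.
Proof.
case/andP=> _ /existsP[c /andP[cc _]]; rewrite -(size_tuple c).
(* A cycle [x :: p] is the path [rcons p x] from [x] back to [x], so its number of edges is even. *)
case: (tval c) cc => //= x p /is_column_last.
by rewrite last_rcons size_rcons /=; case: is_column; case: odd.
Qed.

Lemma tanner_cycle4 (m n : nat) (H : 'M['F_2]_(m, n)) :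
  has_cycle (tanner H) 4 ->
  exists i1 i2 j1 j2, [/\ i1 != i2, j1 != j2,
    H i1 j1 != 0%R /\ H i1 j2 != 0%R & H i2 j1 != 0%R /\ H i2 j2 != 0%R].
Proof.
case/andP=> _ /existsP[[[|a [|b [|c [|d []]]]] //= _]].
rewrite /ucycleb /= !inE !negb_or andbT.
(* Only the two alternating patterns survive: the cycle starts at a column, or at a row. *)
case: a b c d => [a|a] [b|b] //= [c|c] //= [d|d] //=; rewrite ?andbF //.
  case/andP=> /and4P[ba bc dc da] /and3P[/andP[ac _] bd _].
  by exists b, d, a, c; split=> //.
case/andP=> /and4P[ab cb cd ad] /and3P[/andP[ac _] bd _].
by exists a, c, b, d; split=> //.
Qed.

Lemma containment_mx_neq0 (V : finType) (m n : nat)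
    (row_set : 'I_m -> {set V}) (col_block : 'I_n -> {set V}) i j :
  (containment_mx row_set col_block i j != 0%R) = (row_set i \subset col_block j).
Proof. by rewrite mxE; case: (_ \subset _). Qed.

Theorem proposition3p11
  (t v n : nat) (V : finType) (B : {set {set V}})
  (ht : 2 <= t)
  (hB : packing t t.+1 v B)
  (col_block : 'I_n -> {set V})
  (hcol_inj : injective col_block)
  (hcol_B : forall j : 'I_n, col_block j \in B)
  (row_set : 'I_('C(v, t - 1)) -> {set V})
  (hrow_inj : injective row_set)
  (hrow_all : forall S : {set V}, #|S| = t - 1 <-> exists i, row_set i = S) :
  let M := containment_mx row_set col_block in
  ~~ has_cycle (tanner M) 4 /\ leq_ext 6 (girth (tanner M)).
Proof.
move=> M.
have no4 : ~~ has_cycle (tanner M) 4.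
  apply/negP=> /tanner_cycle4[i1 [i2 [j1 [j2 []]]]] ni nj.
  rewrite !containment_mx_neq0 => -[s11 s12] [s21 s22].
  case/eqP: nj; apply: hcol_inj.
  have card_row i : #|row_set i| = t - 1 by apply/hrow_all; exists i.
  apply: (@packing_block_inj _ _ _ _ _ _ _ (row_set i1 :|: row_set i2) hB);
    rewrite ?subUset ?s11 ?s12 //.
  have := @card_setU_gt _ (row_set i1) (row_set i2).
  rewrite !card_row (inj_eq hrow_inj) => /(_ erefl ni).
  (* Since [t] is positive, exceeding [t - 1] means having at least [t] points. *)
  by rewrite -subSn ?subSS ?subn0 // ltnW.
split=> //; case: girthP => //= g cg _.
have := tanner_cycle_even _ _ _ _ cg; case/andP: (cg) => g_gt2 _.
(* Lengths 0, 1, 2 are not cycles, 3 and 5 are odd, and 4 is excluded by [no4]. *)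
by case: g cg g_gt2 => [|[|[|[|[|[|g]]]]]] // /(negP no4).
Qed.
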